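(* If $\models \{P\}\,W(t,B)\,\{Q\}$ holds and $I$ is a safe invariant for the loop $W(t,B)$ (w.r.t. $P$), then there exists a correct summary $R$ for $W(t,B)$ with respect to $P$ and $Q$.
   Context: States form a set $S$. Commands are relations $C \subseteq S \times \hat S$ with $\hat S = S \uplus \{\mathsf{err}\} \uplus \{\mathrm{brk}(s) \mid s \in S\}$, where $\mathsf{err}$ denotes a runtime error outcome and $\mathrm{brk}(s)$ denotes early exit of a loop via a break command in state $s$. Validity: $\models \{P\}\,C\,\{Q\}$ iff for all $s,\hat s'$, $P(s) \land C(s,\hat s') \implies Q(\hat s')$, where $P,Q \subseteq S$. The loop $W(t,B)$ with test $t\subseteq S$ and body $B\subseteq S\times\hat S$ is the least relation with: $\lnot t(s) \implies W(t,B)(s,s)$; $t(s)\land B(s,\mathsf{err}) \implies W(t,B)(s,\mathsf{err})$; $t(s)\land B(s,\mathrm{brk}(s')) \implies W(t,B)(s,s')$; $t(s)\land B(s,s')\land W(t,B)(s',\hat s'') \implies W(t,B)(s,\hat s'')$. $I\subseteq S$ is an invariant w.r.t. $P$ if $P(s_0)\implies I(s_0)$ and $I(s)\land t(s)\land B(s,s')\implies I(s')$; safe if additionally $I(s)\land t(s)\land B(s,\mathsf{err})\implies\mathit{false}$. $R\subseteq S\times S$ is a summary if $\lnot t(s_n)\implies R(s_n,s_n)$; $t(s)\land B(s,\mathrm{brk}(s_n))\implies R(s,s_n)$; $t(s)\land B(s,s')\land R(s',s_n)\implies R(s,s_n)$; it is correct w.r.t. $P,Q$ if also $P(s_0)\land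 R(s_0,s_n)\implies Q(s_n)$. *)

(* Defs.v *)
(* Subsets are predicates, relations are Prop-valued functions of two arguments. *)
Set Implicit Arguments.

(* The set of outcomes  S + {err} + {brk(s) | s in S}. *)
Inductive outcome (S : Type) : Type :=
| norm (s : S)
| err
| brk (s : S).
Arguments err {S}.

Definition command (S : Type) : Type := S -> outcome S -> Prop.

(* A subset of S seen as a subset of the outcomes along the inclusion [norm]:
   err and brk(s) do not belong to it. *)
Definition on_outcome (S : Type) (Q : S -> Prop) (o : outcome S) : Prop :=
  match o with
  | norm s => Q s
  | err => False
  | brk _ => False
  end.

Definition valid (S : Type) (P : S -> Prop) (C : command S) (Q : S -> Prop) : Prop :=
  forall (s : S) (o : outcome S), P s -> C s o -> on_outcome Q o.

Inductive loop (S : Type) (t : S -> Prop) (B : command S) : command S :=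
| loop_exit (s : S) :
    ~ t s -> loop t B s (norm s)
| loop_err (s : S) :
    t s -> B s err -> loop t B s err
| loop_brk (s s' : S) :
    t s -> B s (brk s') -> loop t B s (norm s')
| loop_step (s s' : S) (o : outcome S) :
    t s -> B s (norm s') -> loop t B s' o -> loop t B s o.

Definition invariant (S : Type) (t : S -> Prop) (B : command S) (P I : S -> Prop) : Prop :=
  (forall s0 : S, P s0 -> I s0) /\
  (forall s s' : S, I s -> t s -> B s (norm s') -> I s').

Definition safe_invariant (S : Type) (t : S -> Prop) (B : command S) (P I : S -> Prop) : Prop :=
  invariant t B P I /\
  (forall s : S, I s -> t s -> B s err -> False).

Definition summary (S : Type) (t : S -> Prop) (B : command S) (R : S -> S -> Prop) : Prop :=
  (forall sn : S, ~ t sn -> R sn sn) /\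
  (forall s sn : S, t s -> B s (brk sn) -> R s sn) /\
  (forall s s' sn : S, t s -> B s (norm s') -> R s' sn -> R s sn).

Definition correct_summary (S : Type) (t : S -> Prop) (B : command S)
    (P Q : S -> Prop) (R : S -> S -> Prop) : Prop :=
  summary t B R /\
  (forall s0 sn : S, P s0 -> R s0 sn -> Q sn).

(* Main.v *)
Require Import Defs.

(** The loop's own input-output relation, restricted to normal outcomes, is the witness: the closure
    conditions of a summary are exactly the rules [loop_exit], [loop_brk] and [loop_step] at
    outcomes [norm sn]. Correctness is then validity at such an outcome. *)

Theorem theorem4 (S : Type) (t : S -> Prop) (B : command S) (P Q I : S -> Prop)
    (hvalid : valid P (loop t B) Q)
    (hsafe : safe_invariant t B P I) :
  exists R : S -> S -> Prop, correct_summary t B P Q R.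
Proof.
  exists (fun s sn => loop t B s (norm sn)).
  split; [split; [|split] |].
  - intros sn Ht; now apply loop_exit.
  - intros s sn Ht HB; now apply loop_brk.
  - intros s s' sn Ht HB HW; now apply loop_step with s'.
  (* [on_outcome Q (norm sn)] reduces to [Q sn]. *)
  - intros s0 sn HP HW; exact (hvalid s0 (norm sn) HP HW).
Qed.
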